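(* Let $3\le\alpha<\omega$. Any complete axiom system for $L_\alpha$ must contain, for any $n<\omega$, a formula $\varphi$ with the following three properties: (i) at least $n$ distinct relation symbols occur in $\varphi$; (ii) both $R_i(v_{\tau 0},\dots,v_{\tau(\alpha-1)})$ and $R_i(v_{\sigma 0},\dots,v_{\sigma(\alpha-1)})$ occur in $\varphi$, for some $i<\omega$ and distinct permutations $\tau,\sigma$ of $\alpha$; (iii) existential quantifier $\exists$, equality symbol $=$ and disjunction $\lor$ all occur in $\varphi$.
   Context: $L_\alpha$ is $\alpha$-variable first-order logic: there are infinitely many $\alpha$-place relation symbols $R_i$, $i<\omega$; the variables are $v_0,\dots,v_{\alpha-1}$. Atomic formulas are $R_k(v_{i_1},\dots,v_{i_\alpha})$ (relational atomic formulas, $k<\omega$, $i_1,\dots,i_\alpha<\alpha$) and $v_i=v_j$ ($i,j<\alpha$). Formulas are built from atomic ones by $\lnot$, $\exists v_i$ and $\lor$; the connectives $\land,\to,\forall v_i$ are the usual abbreviations. A formula is valid, or a tautology, iff it is true in each (standard first-order) model under each evaluation of the variables. Detachment: from $\varphi$ and $\varphi\to\psi$ infer $\psi$. Generalization: from $\varphi$ infer $\forall v_i\varphi$ ($i<\alpha$). For $\tau:\alpha\to\alpha$ and a formula $\varphi$, $S(\tau)\varphi$ is defined recursively: $S(\tau)R(v_{i_1},\dots,v_{i_\alpha})$ is $R(v_{\tau(i_1)},\dots,v_{\tau(i_\alpha)})$; $S(\tau)(v_i=v_j)$ is $v_{\tau(i)}=v_{\tau(j)}$; $S(\tau)\lnot\varphi$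 is $\lnot S(\tau)\varphi$; $S(\tau)(\varphi\lor\psi)$ is $S(\tau)\varphi\lor S(\tau)\psi$; $S(\tau)\exists v_i\varphi$ is $\exists v_jS(\sigma)\varphi$, where $j$ is the least element of $\alpha\setminus\{\tau(k): i\neq k<\alpha\}$, $\sigma(i)=j$ and $\sigma(k)=\tau(k)$ for all $k\neq i$. If $\delta$ is any assignment of formulas to relation symbols, the corresponding instance of $\varphi$ is the formula obtained from $\varphi$ by substituting $S(\tau)\delta(R_i)$ for $R_i(v_{\tau(0)},\dots,v_{\tau(\alpha-1)})$ (for each relational atomic formula, $\tau:\alpha\to\alpha$), simultaneously for all relation symbols $R_i$. $Inst(\Gamma)$ is the set of all instances of members of $\Gamma$. A complete axiom system for $L_\alpha$ is a set $\Gamma$ of tautologies such that all other tautologies can be derived from $Inst(\Gamma)$ by a series of uses of Detachment and Generalization. *)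

(* Defs.v *)
From mathcomp Require Import all_boot all_fingroup.

Set Implicit Arguments.
Unset Strict Implicit.
Unset Printing Implicit Defensive.

(** [Rel k t] is the atomic formula R_k(v_{t 0}, ..., v_{t (a-1)}).  The
    constructors are exactly the primitive symbols; the other connectives are
    abbreviations, so that "the symbol occurs in the formula" is syntactic. *)
Inductive form (a : nat) : Type :=
| Rel of nat & {ffun 'I_a -> 'I_a}
| Eql of 'I_a & 'I_a
| Neg of form a
| Or of form a & form a
| Ex of 'I_a & form a.

Arguments Rel {a} k t.
Arguments Eql {a} i j.

Definition Imp a (p q : form a) : form a := Or (Neg p) q.
Definition All a (i : 'I_a) (p : form a) : form a := Neg (Ex i (Neg p)).

Definition update a (T : Type) (e : {ffun 'I_a -> T}) (i : 'I_a) (x : T) :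
    {ffun 'I_a -> T} :=
  [ffun k => if k == i then x else e k].

(** Nonemptiness of the domain is not required separately: for [0 < a] an empty
    domain admits no evaluation, hence falsifies no formula. *)
Record model (a : nat) : Type := Model {
  dom :> Type;
  interp : nat -> {ffun 'I_a -> dom} -> Prop
}.

Fixpoint holds a (M : model a) (e : {ffun 'I_a -> M}) (p : form a) : Prop :=
  match p with
  | Rel k t => interp k [ffun i => e (t i)]
  | Eql i j => e i = e j
  | Neg q => ~ holds e q
  | Or q r => holds e q \/ holds e r
  | Ex i q => exists x : M, holds (update e i x) q
  end.

Definition tautology a (p : form a) : Prop :=
  forall (M : model a) (e : {ffun 'I_a -> M}), holds e p.

(** The default value [i] of [arg min] is never used, as shown by [freshP]. *)
Definition fresh a (t : {ffun 'I_a -> 'I_a}) (i : 'I_a) : 'I_a :=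
  [arg min_(j < i | j \notin [set t k | k in [set~ i]]) (j : nat)].

Lemma freshP a (t : {ffun 'I_a -> 'I_a}) (i : 'I_a) :
  fresh t i \notin [set t k | k in [set~ i]] /\
  forall j, j \notin [set t k | k in [set~ i]] -> fresh t i <= j.
Proof.
set A := [set t k | k in [set~ i]].
have /subsetPn[j0 _ j0A] : ~~ ([set: 'I_a] \subset A).
  apply/negP => /subset_leq_card; rewrite cardsT => /leq_trans.
  move=> /(_ _ (leq_imset_card _ _)); rewrite cardsC1 card_ord.
  by case: a t i @A => [t []|a t i A] //; rewrite ltnn.
rewrite /fresh /arg_min /extremum; case: pickP => [j /andP[jA /forallP jmin]|no].
  by split=> // k kA; exact: (implyP (jmin k)).
case: (@arg_minnP _ j0 [pred j | j \notin A] (fun j => j : nat) j0A) => j jA jmin.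
have /negP[] := no j; apply/andP; split=> //.
by apply/forallP => k; apply/implyP => /jmin.
Qed.

(** The capture-avoiding S(t); under [Ex i], [update t i (fresh t i)] is the map
    sending [i] to the fresh index and agreeing with [t] elsewhere. *)
Fixpoint subst a (t : {ffun 'I_a -> 'I_a}) (p : form a) : form a :=
  match p with
  | Rel k r => Rel k [ffun i => t (r i)]
  | Eql i j => Eql (t i) (t j)
  | Neg q => Neg (subst t q)
  | Or q r => Or (subst t q) (subst t r)
  | Ex i q => let j := fresh t i in Ex j (subst (update t i j) q)
  end.

(** [Rel k t] stands for S(t) applied to R_k(v_0, ..., v_{a-1}), so it is
    replaced by S(t) applied to the formula assigned to R_k. *)
Fixpoint instance a (d : nat -> form a) (p : form a) : form a :=
  match p with
  | Rel k t => subst t (d k)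
  | Eql i j => Eql i j
  | Neg q => Neg (instance d q)
  | Or q r => Or (instance d q) (instance d r)
  | Ex i q => Ex i (instance d q)
  end.

Definition Inst a (G : form a -> Prop) (p : form a) : Prop :=
  exists (d : nat -> form a) (q : form a), G q /\ p = instance d q.

Inductive derivable a (H : form a -> Prop) : form a -> Prop :=
| derivable_hyp p : H p -> derivable H p
| derivable_det p q : derivable H p -> derivable H (Imp p q) -> derivable H q
| derivable_gen i p : derivable H p -> derivable H (All i p).

(** The restriction to tautologies outside [G] is harmless, since [G] is
    included in [Inst G] (see [sub_Inst]). *)
Definition complete_axiom_system a (G : form a -> Prop) : Prop :=
  (forall p, G p -> tautology p) /\
  (forall p, tautology p -> ~ G p -> derivable (Inst G) p).

Lemma sub_Inst a (G : form a -> Prop) (p : form a) : G p -> Inst G p.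
Proof.
move=> Gp; exists (fun k => Rel k [ffun i => i]), p; split=> //.
elim: p {Gp} => [k t|i j|q {1}->|q {1}-> r {1}->|i q {1}->] //=.
by congr Rel; apply/ffunP => i; rewrite !ffunE.
Qed.

Fixpoint rel_atoms a (p : form a) : seq (nat * {ffun 'I_a -> 'I_a}) :=
  match p with
  | Rel k t => [:: (k, t)]
  | Eql _ _ => [::]
  | Neg q => rel_atoms q
  | Or q r => rel_atoms q ++ rel_atoms r
  | Ex _ q => rel_atoms q
  end.

Definition rel_symbols a (p : form a) : seq nat :=
  undup [seq x.1 | x <- rel_atoms p].

Fixpoint Ex_occurs a (p : form a) : bool :=
  match p with
  | Rel _ _ | Eql _ _ => false
  | Neg q => Ex_occurs q
  | Or q r => Ex_occurs q || Ex_occurs r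
  | Ex _ _ => true
  end.

Fixpoint Eql_occurs a (p : form a) : bool :=
  match p with
  | Rel _ _ => false
  | Eql _ _ => true
  | Neg q | Ex _ q => Eql_occurs q
  | Or q r => Eql_occurs q || Eql_occurs r
  end.

Fixpoint Or_occurs a (p : form a) : bool :=
  match p with
  | Rel _ _ | Eql _ _ => false
  | Neg q | Ex _ q => Or_occurs q
  | Or _ _ => true
  end.

(* Main.v *)
Require Import Defs.
From mathcomp Require Import all_boot all_fingroup.
From mathcomp Require Import ssralg finalg zmodp boolp.

(** Suppose that some complete system G contains no formula with the required
    properties for n.  A non-standard semantics is built in which every member
    of G is valid under all substitutions of formulas for relation symbols and
    in which detachment and generalization are sound, although some tautology
    fails in it.

    The semantics is the splitting of an ordinary structure.  A formula is
    evaluated at a pair (e, j) of an evaluation e and a colour j, and the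
    existential quantifier chooses a new value together with an arbitrary new
    colour ([cholds]).  So one tuple carries all the colours at once.  The
    colour may be seen only on special tuples, the rainbows: two coordinates
    are distinct elements of a finite abelian group T of odd order N, and the
    other coordinates lie in pairwise distinct further copies of T.  There are
    N - 1 colours, and permuting the coordinates of a rainbow does not change
    its colour.  The admissible valuations ([tame]) are also invariant under
    independent permutations of the copies of T.  The domain finally has all
    bijections from T to T, regarded as labellings of the first copy; they
    allow a formula with three variables to say that this copy has exactly N
    elements.

    In an ordinary model, each rainbow has a single colour.  If every element
    of the first copy is joined to some other element in every colour, then
    each of the N - 1 colours is a perfect matching of the N elements, which is
    absurd since N is odd ([no_symmetric_edge_colouring]).  The tautology
    [parity_formula] says this, and it fails in the split structure
    ([parity_formula_not_valid]).

    To see that a tautology p is valid in the split structure, it suffices to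
    find an ordinary model whose tuples carry one colour each, so that moving
    one coordinate of a rainbow within its copy produces all the colours that p
    can tell apart ([transfer]).  Each missing property provides one:
    - few relation symbols: these distinguish few classes of colours, so each
      class contains the colours of two values of the sum of the coordinates.
      One of them survives the ban on equal values in the first copy
      ([few_symbols_valid]);
    - one permutation per symbol: the colour need not be symmetric, and
      essentially the difference x - y of the two coordinates in T takes each
      of the N - 1 colours, for a fixed x as well as for a fixed y
      ([single_permutation_valid]);
    - no equality: every element is replaced by many copies, and the colour is
      read from the copies ([equality_free_valid]);
    - no quantifier: the colour never changes ([quantifier_free_valid]);
    - no disjunction: the formula has at most one relation symbol. *)

Set Implicit Arguments.
Unset Strict Implicit.
Unset Printing Implicit Defensive.

Import GRing.Theory.

(** * Evaluations and their updates *)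

Local Notation "f '@@' g" := [ffun i => f (g i)]
  (at level 40, left associativity).

Lemma updateE a T (e : {ffun 'I_a -> T}) i x k :
  update e i x k = if k == i then x else e k.
Proof. by rewrite ffunE. Qed.

Lemma update_same a T (e : {ffun 'I_a -> T}) i : update e i (e i) = e.
Proof. by apply/ffunP => k; rewrite updateE; case: eqP => [->|]. Qed.

Lemma update_update a T (e : {ffun 'I_a -> T}) i x y :
  update (update e i x) i y = update e i y.
Proof. by apply/ffunP => k; rewrite !updateE; case: eqP. Qed.

Lemma comp_update a T T' (h : T -> T') (e : {ffun 'I_a -> T}) i x :
  h @@ update e i x = update (h @@ e) i (h x).
Proof. by apply/ffunP => k; rewrite !ffunE; case: eqP. Qed.

(** The freshness of the new variable makes renaming commute with the choice
    of a witness; this is what capture-avoiding substitution needs. *)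
Lemma update_fresh a T (e : {ffun 'I_a -> T}) (t : {ffun 'I_a -> 'I_a}) i x :
  update e (fresh t i) x @@ update t i (fresh t i) = update (e @@ t) i x.
Proof.
have [jP _] := freshP t i; apply/ffunP => k; rewrite !ffunE.
case: (k =P i) => [_|/eqP ki]; first by rewrite eqxx.
case: eqP => // tk; case/negP: jP; apply/imsetP; exists k => //.
by rewrite !inE.
Qed.

(** * The coloured semantics and its soundness *)

Section ColouredSemantics.
Variables (a : nat) (U J : Type).

Definition valuation := nat -> {ffun 'I_a -> U} -> J -> Prop.

Fixpoint cholds (X : valuation) (e : {ffun 'I_a -> U}) (j : J) (p : form a) :
    Prop :=
  match p with
  | Rel k t => X k (e @@ t) j
  | Eql i l => e i = e l
  | Neg q => ~ cholds X e j q
  | Or q r => cholds X e j q \/ cholds X e j r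
  | Ex i q => exists u j', cholds X (update e i u) j' q
  end.

Lemma cholds_subst X t p e j :
  cholds X e j (subst t p) <-> cholds X (e @@ t) j p.
Proof.
elim: p t e j => [k r|i l|q IH|q IHq r IHr|i q IH] t e j /=.
- suff -> : e @@ [ffun i => t (r i)] = (e @@ t) @@ r by [].
  by apply/ffunP => i; rewrite !ffunE.
- by rewrite !ffunE.
- by rewrite IH.
- by rewrite IHq IHr.
- by split=> -[u [j' H]]; exists u, j'; move: H; rewrite IH update_fresh.
Qed.

Definition induced X (d : nat -> form a) : valuation :=
  fun k e j => cholds X e j (d k).

Lemma cholds_instance X d p e j :
  cholds X e j (instance d p) <-> cholds (induced X d) e j p.
Proof.
elim: p e j => [k t|//|q IH|q IHq r IHr|i q IH] e j /=.
- exact: cholds_subst.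
- by rewrite IH.
- by rewrite IHq IHr.
- by split=> -[u [j' H]]; exists u, j'; apply/IH.
Qed.

Definition cvalid (V : valuation -> Prop) p :=
  forall X, V X -> forall e j, cholds X e j p.

(** The only demand on the class of valuations is closure under definability;
    detachment and generalization are sound for any valuation. *)
Lemma derivable_cvalid V G p :
    (forall X d, V X -> V (induced X d)) ->
  (forall q, G q -> cvalid V q) -> derivable (Inst G) p -> cvalid V p.
Proof.
move=> Vd VG; elim=> [_ [d [r [Gr ->]]]|q r _ IHq _ IHr|i q _ IH] X VX e j.
- by apply/cholds_instance; apply: VG Gr _ (Vd _ _ VX) _ _.
- by case: (IHr X VX e j) => // -[]; apply: IHq.
- by case=> u [j'] []; apply: IH.
Qed.

(** An ordinary model simulates the coloured semantics when each of its
    evaluations e is given a colour c e and a single new value x can play the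
    part of an arbitrary pair of a value u and a colour j.  Such an x need only
    yield a pair that the subformulas of p cannot distinguish from the required
    one, and equality and quantification are constrained only if p uses
    them. *)
Lemma transfer (X : valuation) (M : model a) (h : M -> U)
    (c : {ffun 'I_a -> M} -> J) p :
    (forall k t, (k, t) \in rel_atoms p ->
       forall e : {ffun 'I_a -> M},
         interp k (e @@ t) <-> X k (h @@ (e @@ t)) (c e)) ->
    (Eql_occurs p -> injective h) ->
    (Ex_occurs p -> forall e i u j, exists x,
       forall q, {subset rel_atoms q <= rel_atoms p} ->
         cholds X (h @@ update e i x) (c (update e i x)) q <->
         cholds X (update (h @@ e) i u) j q) ->
  forall e, holds e p <-> cholds X (h @@ e) (c e) p.
Proof.
move=> atomP eqlP exP.
have compA e (t : {ffun 'I_a -> 'I_a}) : (h @@ e) @@ t = h @@ (e @@ t).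
  by apply/ffunP => i; rewrite !ffunE.
suff sub q : {subset rel_atoms q <= rel_atoms p} ->
    (Eql_occurs q -> Eql_occurs p) -> (Ex_occurs q -> Ex_occurs p) ->
  forall e, holds e q <-> cholds X (h @@ e) (c e) q by exact: sub.
elim: q => [k t|i l|q IH|q IHq r IHr|i q IH] /= sA sE sX e.
- by rewrite compA; apply: atomP; apply: sA; rewrite inE.
- by rewrite !ffunE; split=> [->//|]; apply: eqlP; apply: sE.
- by rewrite IH.
- have [sAq sAr] : {subset rel_atoms q <= rel_atoms p} /\
      {subset rel_atoms r <= rel_atoms p}.
    by split=> x xq; apply: sA; rewrite mem_cat xq ?orbT.
  have [sEq sEr] : (Eql_occurs q -> Eql_occurs p) /\
      (Eql_occurs r -> Eql_occurs p).
    by split=> x; apply: sE; rewrite x ?orbT.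
  have [sXq sXr] : (Ex_occurs q -> Ex_occurs p) /\ (Ex_occurs r -> Ex_occurs p).
    by split=> x; apply: sX; rewrite x ?orbT.
  by rewrite IHq // IHr.
- have {}IH := IH sA sE (fun _ => sX isT).
  split=> [[x /IH Hx]|[u [j Hu]]].
    by exists (h x), (c (update e i x)); rewrite -comp_update.
  have [x xP] := exP (sX isT) e i u j.
  by exists x; apply/IH/xP.
Qed.

(** The quantifier condition, used with the present value of one coordinate
    as u, also shows that every pair of an evaluation and a colour is reached
    up to indistinguishability. *)
Lemma transfer_valid (X : valuation) (M : model a) (h : M -> U)
    (c : {ffun 'I_a -> M} -> J) p :
    0 < a ->
    (forall k t, (k, t) \in rel_atoms p ->
       forall e : {ffun 'I_a -> M},
         interp k (e @@ t) <-> X k (h @@ (e @@ t)) (c e)) ->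
    (Eql_occurs p -> injective h) ->
    (forall u, exists x, h x = u) ->
    (forall e i u j, exists x,
       forall q, {subset rel_atoms q <= rel_atoms p} ->
         cholds X (h @@ update e i x) (c (update e i x)) q <->
         cholds X (update (h @@ e) i u) j q) ->
  tautology p -> forall e j, cholds X e j p.
Proof.
move=> a_gt0 atomP eqlP hP exP taut e j.
have /fin_all_exists[f fP] : forall i, exists x, h x = e i by move=> i.
pose e' : {ffun 'I_a -> M} := [ffun i => f i].
have he' : h @@ e' = e by apply/ffunP => i; rewrite !ffunE.
pose i0 := Ordinal a_gt0; have [x xP] := exP e' i0 (e i0) j.
have /= xp := xP p (fun _ H => H); rewrite he' update_same in xp.
by apply/xp/(transfer atomP eqlP (fun _ => exP)); apply: taut.
Qed.

End ColouredSemantics.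

Lemma comp_id a U (e : {ffun 'I_a -> U}) : id @@ e = e.
Proof. by apply/ffunP => i; rewrite ffunE. Qed.

Lemma comp_permK a U (e : {ffun 'I_a -> U}) (s : {perm 'I_a}) :
  (e @@ s) @@ (s^-1)%g = e.
Proof. by apply/ffunP => i; rewrite !ffunE permKV. Qed.

(** * Rainbows and the split structure *)

Section Rainbows.
Variables (a : nat) (T : finZmodType).

(** [inl (None, x)] lies in the first copy of T, [inl (Some b, x)] in the copy
    with index b, and [inr l] is a labelling of the first copy. *)
Definition point : Type := (option 'I_a * T) + {perm T}.
Definition colour := {j : T | j != 0%R}.

(** [None] for the labellings, which belong to no copy of T. *)
Definition fibre (u : point) : option (option 'I_a) :=
  if u is inl (b, _) then Some b else None.
Definition coord (u : point) : T := if u is inl (_, x) then x else 0%R.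

Implicit Types (e : {ffun 'I_a -> point}) (X : valuation a point colour).

Definition rainbow (e : {ffun 'I_a -> point}) : Prop :=
  exists i1 i2, [/\ i1 != i2, fibre (e i1) = Some None,
    fibre (e i2) = Some None, coord (e i1) != coord (e i2) &
    forall k, k != i1 -> k != i2 -> exists2 b, fibre (e k) = Some (Some b) &
      forall l, fibre (e l) = Some (Some b) -> l = k].

Variant rainbow_spec (e : {ffun 'I_a -> point}) i : Prop :=
| RainbowLone b of fibre (e i) = Some (Some b) &
    forall l, fibre (e l) = Some (Some b) -> l = i
| RainbowPaired i' of i' != i & fibre (e i) = Some None &
    fibre (e i') = Some None & coord (e i) != coord (e i') &
    forall k, fibre (e k) = Some None -> k = i \/ k = i'.

Lemma rainbowP e i : rainbow e -> rainbow_spec e i.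
Proof.
case=> i1 [i2 [i12 f1 f2 c12 rest]].
have only k : fibre (e k) = Some None -> k = i1 \/ k = i2.
  case: (k =P i1) => [->|/eqP k1]; first by left.
  case: (k =P i2) => [->|/eqP k2]; first by right.
  by have [b ->] := rest k k1 k2.
have [->|ni1] := eqVneq i i1.
  by apply: (@RainbowPaired _ _ i2); rewrite // eq_sym.
have [->|ni2] := eqVneq i i2.
  apply: (@RainbowPaired _ _ i1) => // [|k /only[]]; auto.
  by rewrite eq_sym.
by have [b fb ub] := rest i ni1 ni2; apply: RainbowLone fb ub.
Qed.

Lemma rainbow_inl e i : rainbow e -> exists b x, e i = inl (b, x).
Proof.
by move/(rainbowP i)=> [b|i' _]; case: (e i) => [[b' x]|] //; exists b', x.
Qed.

Lemma rainbow_inj e : rainbow e -> injective e.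
Proof.
move=> re k l ekl; have [b fb ub|k' nk fk fk' ck uk] := rainbowP k re.
  by rewrite (ub l) // -ekl.
have [//|lk'] : l = k \/ l = k' by apply: uk; rewrite -ekl.
by move: ck; rewrite ekl lk' eqxx.
Qed.

(** As rainbows are injective, identifying variables destroys them; only
    permutations of the variables can make colours visible. *)
Lemma rainbow_comp_inj e (t : {ffun 'I_a -> 'I_a}) :
  rainbow (e @@ t) -> exists s : {perm 'I_a}, t = [ffun k => s k].
Proof.
move=> /rainbow_inj inj_et; have t_inj : injective t.
  by move=> k l tkl; apply: inj_et; rewrite !ffunE tkl.
by exists (perm t_inj); apply/ffunP => k; rewrite ffunE permE.
Qed.

Lemma rainbow_perm e (s : {perm 'I_a}) : rainbow e -> rainbow (e @@ s).
Proof.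
case=> i1 [i2 [i12 f1 f2 c12 rest]].
exists (s^-1 i1)%g, (s^-1 i2)%g; rewrite !ffunE !permKV.
split=> // [|k k1 k2]; first by rewrite (inj_eq perm_inj).
have neq i : k != (s^-1 i)%g -> s k != i.
  by apply: contraNneq => <-; rewrite permK.
have [b fb ub] := rest (s k) (neq _ k1) (neq _ k2).
by exists b => [|l]; rewrite !ffunE // => /ub/perm_inj.
Qed.

(** This makes invisibility of the colour outside rainbows stable under
    substitution of variables. *)
Lemma rainbow_of_comp e (t : {ffun 'I_a -> 'I_a}) :
  rainbow (e @@ t) -> rainbow e.
Proof.
move=> re; have [s ts] := rainbow_comp_inj re.
rewrite -(comp_permK e s); apply: rainbow_perm.
suff -> : e @@ s = e @@ t by [].
by apply/ffunP => i; rewrite ts !ffunE.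
Qed.

(** A labelling is composed with the inverse permutation, so that the label of
    an element of the first copy is preserved. *)
Definition act (g : option 'I_a -> {perm T}) (u : point) : point :=
  match u with
  | inl (b, x) => inl (b, g b x)
  | inr l => inr ((g None)^-1 * l)%g
  end.

Lemma actK g u : act (fun b => (g b)^-1)%g (act g u) = u.
Proof. by case: u => [[b x]|l] /=; rewrite ?permK ?invgK ?mulKVg. Qed.

Lemma actKV g u : act g (act (fun b => (g b)^-1)%g u) = u.
Proof. by case: u => [[b x]|l] /=; rewrite ?permKV ?invgK ?mulKg. Qed.

Lemma fibre_act g u : fibre (act g u) = fibre u.
Proof. by case: u => [[]|]. Qed.

Lemma rainbow_act g e : rainbow e -> rainbow (act g @@ e).
Proof.
case=> i1 [i2 [i12 f1 f2 c12 rest]]; exists i1, i2; rewrite !ffunE !fibre_act.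
split=> // [|k k1 k2].
  move: f1 f2 c12; case: (e i1) => [[_ x] [->]|//].
  by case: (e i2) => [[_ y] [->]|//] /=; rewrite (inj_eq perm_inj).
have [b fb ub] := rest k k1 k2.
by exists b => [|l]; rewrite !ffunE fibre_act // => /ub.
Qed.

Definition tame (X : valuation a point colour) : Prop :=
  (forall k e j j', ~ rainbow e -> X k e j -> X k e j') /\
  (forall k g e j, X k e j -> X k (act g @@ e) j).

(** Meanings of formulas inherit both defining properties of tameness, by
    induction on the formula; existential formulas never see the colour. *)
Lemma cholds_colourless X e j j' p : tame X -> ~ rainbow e ->
  cholds X e j p <-> cholds X e j' p.
Proof.
case=> X1 _ nr; elim: p => [k t|//|q IH|q IHq r IHr|//] /=.
- have nr' : ~ rainbow (e @@ t) by move=> /rainbow_of_comp.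
  by split; apply: X1.
- by rewrite IH.
- by rewrite IHq IHr.
Qed.

Lemma cholds_act X g e j p : tame X ->
  cholds X (act g @@ e) j p <-> cholds X e j p.
Proof.
case=> _ X2; have comp e' (t : {ffun 'I_a -> 'I_a}) g' :
  (act g' @@ e') @@ t = act g' @@ (e' @@ t) by apply/ffunP=> i; rewrite !ffunE.
elim: p e j => [k t|i l|q IH|q IHq r IHr|i q IH] e j /=.
- rewrite comp; split; last exact: X2.
  move/(X2 k (fun b => (g b)^-1)%g); congr X.
  by apply/ffunP => i; rewrite !ffunE actK.
- by rewrite !ffunE; split=> [|->//]; apply: (can_inj (actK g)).
- by rewrite IH.
- by rewrite IHq IHr.
- split=> -[u [j' H]].
    exists (act (fun b => (g b)^-1)%g u), j'.
    by apply/IH; rewrite comp_update actKV.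
  by exists (act g u), j'; rewrite -comp_update IH.
Qed.

Lemma tame_induced X d : tame X -> tame (induced X d).
Proof.
move=> tX; split=> [k e j j' nr|k g e j].
  by rewrite /induced (cholds_colourless _ j').
by rewrite /induced cholds_act.
Qed.

(** * Moving one coordinate of a rainbow *)

Definition place (u : point) (v : T) : point :=
  if u is inl (b, _) then inl (b, v) else u.

Definition move e i v : {ffun 'I_a -> point} := update e i (place (e i) v).

Definition allowed (e : {ffun 'I_a -> point}) i v :=
  forall k, k != i -> fibre (e k) = fibre (e i) -> coord (e k) != v.

Lemma fibre_move e i v k : fibre (move e i v k) = fibre (e k).
Proof. by rewrite updateE; case: eqP => // ->; case: (e i) => [[]|]. Qed.

Lemma coord_move e i v : rainbow e -> coord (move e i v i) = v.
Proof.
move=> re; rewrite updateE eqxx.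
by have [b|i' _] := rainbowP i re; case: (e i) => [[]|].
Qed.

Lemma coord_moveD e i v k : k != i -> coord (move e i v k) = coord (e k).
Proof. by move=> ki; rewrite updateE (negPf ki). Qed.

Lemma move_update e i u v :
  move (update e i u) i v = update e i (place u v).
Proof. by rewrite /move update_update updateE eqxx. Qed.

(** The transposition of the old and the new value in the copy of coordinate i
    fixes all the other coordinates, and tame meanings are invariant under
    it.  Thus the colour of a rainbow can be adjusted by moving any one of its
    coordinates, without changing the truth of any formula. *)
Lemma cholds_move X e i v j p : tame X -> rainbow e -> allowed e i v ->
  cholds X (move e i v) j p <-> cholds X e j p.
Proof.
move=> tX re ok.
pose g b := if fibre (e i) == Some b then tperm (coord (e i)) v else 1%g.
rewrite -(cholds_act g e j p tX).
suff -> : move e i v = act g @@ e by [].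
apply/ffunP => k; rewrite updateE ffunE; case: (k =P i) => [->|/eqP ki].
  have [b [x ei]] := rainbow_inl i re; rewrite ei /= /g ei /= eqxx.
  by rewrite tpermL.
have [b [x ek]] := rainbow_inl k re; rewrite ek /= /g.
case: eqP => [fi|_]; last by rewrite perm1.
have := ok k ki; rewrite ek /= fi => /(_ erefl) xv.
rewrite tpermD // 1?eq_sym //; apply: contraNneq ki => ci.
have : e k = e i; last by move/(rainbow_inj re)->.
by move: fi ci; rewrite ek; case: (e i) => [[b' y] /= [->] <-|].
Qed.

Lemma allowed_lone e i v b :
    fibre (e i) = Some (Some b) ->
    (forall l, fibre (e l) = Some (Some b) -> l = i) -> allowed e i v.
Proof. by move=> fi ui k ki; rewrite fi => /ui kk; rewrite kk eqxx in ki. Qed.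

Lemma allowed_paired e i i' v :
    fibre (e i) = Some None ->
    (forall k, fibre (e k) = Some None -> k = i \/ k = i') ->
  coord (e i') != v -> allowed e i v.
Proof.
move=> fi ui iv k ki; rewrite fi => /ui[kk|-> //].
by rewrite kk eqxx in ki.
Qed.

Lemma allowed_two e i v1 v2 : rainbow e -> v1 != v2 ->
  allowed e i v1 \/ allowed e i v2.
Proof.
move=> re v12; have [b fb ub|i' ni fi fi' ci ui] := rainbowP i re.
  by left; apply: allowed_lone fb ub.
have [c1|c1] := eqVneq (coord (e i')) v1; [right|left];
  apply: allowed_paired fi ui _; by rewrite ?c1.
Qed.

(** * Tautologies without quantifiers or without equality *)

(** Without quantifiers the colour j stays constant, so it can be absorbed
    into the interpretation of the relation symbols. *)
Lemma quantifier_free_valid p : ~~ Ex_occurs p -> tautology p -> cvalid tame p.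
Proof.
move=> nEx taut X _ e j.
pose M := @Model a point (fun k e0 => X k e0 j).
have tr : holds (e : {ffun 'I_a -> M}) p <-> cholds X (id @@ e) j p.
  apply: (@transfer a point colour X M id (fun _ => j))
    => [k t _ e'|_ x y //|Exp].
    by rewrite comp_id.
  by case/negP: nEx.
by rewrite comp_id in tr; apply/tr; apply: taut.
Qed.

Variable j0 : colour.

Lemma sum_update (U : Type) (f : U -> T) (e : {ffun 'I_a -> U}) i u :
  (\sum_k f (update e i u k) = f u + \sum_(k | k != i) f (e k))%R.
Proof.
rewrite (bigD1 i) //= updateE eqxx; congr (_ + _)%R.
by apply: eq_bigr => k /negPf ki; rewrite updateE ki.
Qed.

(** Without equality, each point may be replaced by copies of it tagged with
    the elements of T.  The colour is then the sum of the tags, and the tag of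
    the moved coordinate can be chosen to give any colour. *)
Lemma equality_free_valid p : 0 < a -> ~~ Eql_occurs p -> tautology p ->
  cvalid tame p.
Proof.
move=> a_gt0 nEql taut X tX e j.
pose c (e0 : {ffun 'I_a -> point * T}) : colour :=
  insubd j0 (\sum_k (e0 k).2)%R.
pose M := @Model a (point * T) (fun k f => X k (fst @@ f) (c f)).
apply: (@transfer_valid _ _ _ X M fst c) => // {e j} [k t _ e||u|e i u j].
- have [re|nr] := EM (rainbow (fst @@ (e @@ t))); last first.
    by split; apply: (proj1 tX).
  suff ct : c (e @@ t) = c e by rewrite /= ct.
  have [|s ->] := @rainbow_comp_inj (fst @@ e) t.
    by move: re; congr rainbow; apply/ffunP => l; rewrite !ffunE.
  congr (insubd _ _); rewrite [RHS](reindex_inj (@perm_inj _ s)).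
  by apply: eq_bigr => l _; rewrite !ffunE.
- by move=> Eqlp; case/negP: nEql.
- by exists (u, 0%R).
- exists (u, val j - \sum_(k | k != i) (e k).2)%R => q _.
  set v := (_ - _)%R; rewrite comp_update.
  suff -> : c (update e i (u, v)) = j by [].
  by rewrite /c (@sum_update (point * T) snd e i (u, v)) /= subrK valKd.
Qed.

(** * Tautologies with few relation symbols *)

Definition pattern (e : {ffun 'I_a -> point}) := [ffun i => fibre (e i)].

(** Hence what a tame valuation says about a colour on rainbows depends only on
    their patterns, whose number does not depend on T. *)
Lemma rainbow_homogeneous e e' : rainbow e -> rainbow e' ->
  pattern e = pattern e' -> exists g, e' = act g @@ e.
Proof.
move=> re re' pe; have fe k : fibre (e k) = fibre (e' k).
  by have := congr1 (fun f : {ffun _ -> _} => f k) pe; rewrite !ffunE.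
have /fin_all_exists[g gP] (b : option 'I_a) : exists s : {perm T},
    forall k, fibre (e k) = Some b -> s (coord (e k)) = coord (e' k).
  have [[k fk]|none] := EM (exists k, fibre (e k) = Some b); last first.
    by exists 1%g => k fk; case: none; exists k.
  have [b' fb ub|k' nk fk0 fk' ck uk] := rainbowP k re.
    exists (tperm (coord (e k)) (coord (e' k))) => l; rewrite -fk fb => /ub->.
    by rewrite tpermL.
  have ck' : coord (e' k) != coord (e' k').
    case: (rainbowP k re') => [b'|k2 nk2 f2 f2' c2 u2].
      by rewrite -fe fk0.
    have [kk|->//] : k' = k \/ k' = k2 by apply: u2; rewrite -fe.
    by rewrite kk eqxx in nk.
  (* Two points of the first copy are sent to two given ones by transpositions:
     s1 settles the first point, and the second factor does not move it. *)
  pose s1 := tperm (coord (e k)) (coord (e' k)).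
  exists (s1 * tperm (s1 (coord (e k'))) (coord (e' k')))%g => l.
  rewrite -fk fk0 => /uk[]->; rewrite permM; last by rewrite tpermL.
  rewrite [s1 (coord (e k))]tpermL tpermD // eq_sym //.
  by rewrite -[X in X != _](tpermL (coord (e k))) (inj_eq perm_inj).
exists g; apply/ffunP => k; rewrite ffunE.
have := gP^~ k; have := fe k.
have [b [x ->]] := rainbow_inl k re; have [b' [y ->]] := rainbow_inl k re'.
by move=> [->] /(_ _ erefl) /= ->.
Qed.

(** Two values s for each class, since one value may be forbidden when a
    coordinate moves inside the first copy. *)
Lemma doubled_section (S V : finType) (t : colour -> V) : #|V|.*2 <= #|S| ->
  exists f : S -> colour, forall j, exists s1 s2,
    [/\ s1 != s2, t (f s1) = t j & t (f s2) = t j].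
Proof.
move=> VS; pose ok (s : S) j := enum_rank (t j) == (enum_rank s)./2 :> nat.
exists (fun s => odflt j0 [pick j | ok s j]) => j.
have lt_rank (b : bool) : b + (enum_rank (t j)).*2 < #|S|.
  apply: leq_trans VS; have := ltn_ord (enum_rank (t j)).
  by rewrite -(leq_double _.+1) doubleS; apply: leq_trans; case: b.
pose s b : S := enum_val (Ordinal (lt_rank b)).
have rank_s b : enum_rank (s b) = b + (enum_rank (t j)).*2 :> nat.
  by rewrite enum_valK.
have ts b : t (odflt j0 [pick j' | ok (s b) j']) = t j.
  rewrite /ok rank_s half_bit_double; case: pickP => [j' /eqP rj|/(_ j)] /=.
    by apply: enum_rank_inj; apply: val_inj.
  by rewrite eqxx.
exists (s true), (s false); split=> //; apply/eqP => ss.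
by have := rank_s true; rewrite ss rank_s => /eqP; rewrite eqn_add2r.
Qed.

(** The record of which of n relation symbols hold, in a given colour, on
    rainbows of each pattern. *)
Definition colour_type n : Type :=
  {ffun 'I_n * {ffun 'I_a -> option (option 'I_a)} -> bool}.

(** The symbols of p cannot distinguish colours of equal type.  So a rainbow
    may be given a colour that depends only on the sum of its coordinates,
    which is invariant under permutations of the variables, provided that each
    type has two sums: when a coordinate moves, at most one value is
    forbidden. *)
Lemma few_symbols_valid p : 0 < a ->
    #|{: colour_type (size (rel_symbols p))}|.*2 <= #|T| ->
  tautology p -> cvalid tame p.
Proof.
move=> a_gt0; set n := size _; set sym := rel_symbols p in n *.
move=> type_le taut X tX e j.
pose typ (j : colour) : colour_type n := [ffun kf : 'I_n * _ =>
  `[< exists e, [/\ rainbow e, pattern e = kf.2 & X (nth 0 sym kf.1) e j] >]].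
have typP j1 j2 k : typ j1 = typ j2 -> k \in sym -> forall e,
    X k e j1 -> X k e j2.
  move=> tj ks e0 Xe; have [re|nr] := EM (rainbow e0); last first.
    exact: (proj1 tX) Xe.
  have lt_k : index k sym < n by rewrite index_mem.
  have : typ j1 (Ordinal lt_k, pattern e0).
    by rewrite ffunE /= nth_index //; apply/asboolP; exists e0.
  rewrite tj ffunE /= nth_index // => /asboolP[e1 [re1 pe1 Xe1]].
  have [g ->] := rainbow_homogeneous re1 re pe1.
  exact: (proj2 tX).
have symP q : {subset rel_atoms q <= rel_atoms p} ->
    forall j1 j2 e, typ j1 = typ j2 -> cholds X e j1 q <-> cholds X e j2 q.
  move=> + j1 j2 + tj; elim: q => [k t|//|q IH|q IHq r IHr|//] /= sA e0.
  - have ks : k \in sym.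
      rewrite mem_undup; apply/mapP; exists (k, t) => //.
      by apply: sA; rewrite inE.
    by split; apply: typP.
  - by rewrite IH.
  - by rewrite IHq ?IHr // => x xq; apply: sA; rewrite mem_cat xq ?orbT.
have [f fP] := doubled_section typ type_le.
pose c (e0 : {ffun 'I_a -> point}) : colour := f (\sum_k coord (e0 k))%R.
pose M := @Model a point (fun k e0 => X k e0 (c e0)).
apply: (@transfer_valid _ _ _ X M id c) => // {e j} [k t _ e|_ x y|u|e i u j].
- rewrite comp_id; have [re|nr] := EM (rainbow (e @@ t)); last first.
    by split; apply: (proj1 tX).
  suff ct : c (e @@ t) = c e by rewrite /= ct.
  have [s ->] := rainbow_comp_inj re.
  congr (f _); rewrite [RHS](reindex_inj (@perm_inj _ s)).
  by apply: eq_bigr => l _; rewrite !ffunE.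
- by [].
- by exists u.
- have [re|nr] := EM (rainbow (update e i u)); last first.
    by exists u => q _; rewrite !comp_id; apply: cholds_colourless.
  pose rest := (\sum_(k | k != i) coord (e k))%R.
  have [s1 [s2 [s12 ts1 ts2]]] := fP j.
  have [v [okv tv]] : exists v,
      allowed (update e i u) i v /\ typ (f (v + rest)%R) = typ j.
    have [|ok|ok] := @allowed_two _ i (s1 - rest)%R (s2 - rest)%R re.
    - by rewrite (inj_eq (addIr _)).
    - by exists (s1 - rest)%R; rewrite subrK.
    - by exists (s2 - rest)%R; rewrite subrK.
  exists (place u v) => q sq; rewrite !comp_id -(cholds_move j q tX re okv).
  rewrite move_update; apply: symP => //; rewrite -tv; congr (typ (f _)).
  rewrite (sum_update coord); congr (_ + _)%R.
  by have := coord_move i v re; rewrite move_update updateE eqxx.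
Qed.

(** * Tautologies with one permutation for each relation symbol *)

(** The difference of the two coordinates in the first copy has a sign, fixed
    here by taking first the coordinate picked by [leader]; the choice depends
    only on the pattern and survives moves.  It is this dependence on the order
    of the variables that makes the colouring non-symmetric. *)
Definition leader e : option 'I_a := [pick i | fibre (e i) == Some None].

(** Twice the first coordinate minus the sum of both: their difference. *)
Definition gap e : T :=
  ((if leader e is Some i then coord (e i) else 0) *+ 2
    - \sum_(i | fibre (e i) == Some None) coord (e i))%R.

Definition offset e : T :=
  (\sum_(i | fibre (e i) != Some None) coord (e i))%R.

Lemma leader_move e i v : leader (move e i v) = leader e.
Proof. by apply: eq_pick => k; rewrite fibre_move. Qed.

Lemma gap_paired e i i' : i' != i -> fibre (e i) = Some None ->
    fibre (e i') = Some None ->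
    (forall k, fibre (e k) = Some None -> k = i \/ k = i') ->
  gap e = if leader e == Some i then (coord (e i) - coord (e i'))%R
          else (coord (e i') - coord (e i))%R.
Proof.
move=> ni fi fi' ui; rewrite /gap (bigD1 i) /= ?fi //.
rewrite (bigD1 i') /= ?fi' ?eqxx // big1 => [|k]; last first.
  by case/andP => /andP[/eqP/ui[]->]; rewrite eqxx.
rewrite addr0 /leader; case: pickP => [k /eqP/ui[]->|/(_ i)].
- by rewrite eqxx mulr2n opprD addrA addrK.
- rewrite [Some _ == _](negPf ni) mulr2n opprD addrA.
  by rewrite [(_ - coord (e i))%R]addrAC addrK.
- by rewrite fi eqxx.
Qed.

Lemma offset_move_paired e i v : fibre (e i) = Some None ->
  offset (move e i v) = offset e.
Proof.
move=> fi; apply: congr_big => // k; rewrite fibre_move // => fk.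
by rewrite coord_moveD //; apply: contraNneq fk => ->; rewrite fi.
Qed.

Lemma offset_move_lone e i v : rainbow e -> fibre (e i) != Some None ->
  offset (move e i v) =
    (v + \sum_(k | (fibre (e k) != Some None) && (k != i)) coord (e k))%R.
Proof.
move=> re fi; rewrite /offset (bigD1 i) ?fibre_move //= coord_move //.
congr (_ + _)%R; apply: eq_big => k; first by rewrite fibre_move.
by case/andP=> _ ki; rewrite coord_moveD.
Qed.

Lemma gap_move_lone e i v : fibre (e i) != Some None ->
  gap (move e i v) = gap e.
Proof.
move=> fi; have same k : fibre (e k) == Some None ->
    coord (move e i v k) = coord (e k).
  by move=> fk; rewrite coord_moveD //; apply: contraTneq fk => ->.
rewrite /gap leader_move; congr (_ *+ 2 - _)%R.
  by rewrite /leader; case: pickP => // k /same.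
by apply: congr_big => // k; rewrite fibre_move // => /same.
Qed.

(** A combination of two elements of T which, for d <> 0, takes every nonzero
    value both as d varies over the nonzero elements with s fixed
    ([mix_gap]) and as s varies with d fixed ([mix_offset]).  Plain d + s
    misses the value s and takes the value 0 instead. *)
Definition mix (d s : T) : T := if (d + s == 0)%R then s else (d + s)%R.

Lemma mix_gap (j s : T) : (j != 0 -> exists2 d, d != 0 & mix d s = j)%R.
Proof.
have [->|js] := eqVneq j s => s0.
  by exists (- s)%R; rewrite ?oppr_eq0 // /mix addNr eqxx.
by exists (j - s)%R; rewrite ?subr_eq0 // /mix subrK (negPf s0).
Qed.

Lemma mix_offset (j d : T) : (j != 0 -> mix d (j - d) = j)%R.
Proof. by move=> jn; rewrite /mix addrC subrK (negPf jn). Qed.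

(** Each relation symbol k is interpreted by reading the colour after undoing
    the one permutation pi k with which k occurs.  Atoms with a non-injective
    map of variables never see colours.  So the colour of a tuple need not agree
    with the colours of its permutations. *)
Lemma single_permutation_valid p : 0 < a ->
    (forall k (s t : {perm 'I_a}), (k, [ffun i => s i]) \in rel_atoms p ->
       (k, [ffun i => t i]) \in rel_atoms p -> s = t) ->
  tautology p -> cvalid tame p.
Proof.
move=> a_gt0 uniq_perm taut X tX e j.
pose c (e0 : {ffun 'I_a -> point}) : colour :=
  insubd j0 (mix (gap e0) (offset e0)).
pose pi k : {perm 'I_a} :=
  odflt 1%g [pick s : {perm 'I_a} | (k, [ffun i => s i]) \in rel_atoms p].
have piP k (s : {perm 'I_a}) : (k, [ffun i => s i]) \in rel_atoms p -> pi k = s.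
  rewrite /pi; case: pickP => [s' /uniq_perm us /us ->//|/(_ s)-> //].
pose M := @Model a point (fun k e0 => X k e0 (c (e0 @@ (pi k)^-1%g))).
apply: (@transfer_valid _ _ _ X M id c) => // {e j} [k t kt e|_ x y|u|e i u j].
- rewrite comp_id; have [re|nr] := EM (rainbow (e @@ t)); last first.
    by split; apply: (proj1 tX).
  have [s ts] := rainbow_comp_inj re.
  suff et : (e @@ t) @@ (pi k)^-1%g = e by rewrite /= et.
  rewrite ts in kt *; rewrite (piP _ _ kt); apply/ffunP => l.
  by rewrite !ffunE permKV.
- by [].
- by exists u.
- have [re|nr] := EM (rainbow (update e i u)); last first.
    by exists u => q _; rewrite !comp_id; apply: cholds_colourless.
  have [v [okv cv]] : exists v, allowed (update e i u) i v /\
      mix (gap (move (update e i u) i v)) (offset (move (update e i u) i v))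
        = val j.
    move: (update e i u) re => {u}e re.
    have [b fb ub|i' ni fi fi' ci ui] := rainbowP i re.
      have fi : fibre (e i) != Some None by rewrite fb.
      set rest :=
        (\sum_(k | (fibre (e k) != Some None) && (k != i)) coord (e k))%R.
      exists (val j - gap e - rest)%R; split; first exact: allowed_lone fb ub.
      rewrite gap_move_lone // offset_move_lone // subrK.
      exact: mix_offset (valP j).
    have [d d0 dj] := mix_gap (offset e) (valP j).
    have gapE v : gap (move e i v) = if leader e == Some i
        then (v - coord (e i'))%R else (coord (e i') - v)%R.
      rewrite (@gap_paired _ i i') ?fibre_move // => [|k].
        by rewrite leader_move coord_move // coord_moveD.
      by rewrite fibre_move; apply: ui.
    exists (if leader e == Some i then d + coord (e i')
            else coord (e i') - d)%R.
    split; last first.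
      rewrite offset_move_paired // gapE; case: (leader e == Some i).
        by rewrite addrK.
      by rewrite opprB addrC subrK.
    apply: allowed_paired fi ui _; rewrite eq_sym -subr_eq0.
    by case: ifP => _; rewrite ?addrK // addrAC subrr sub0r oppr_eq0.
  exists (place u v) => q sq; rewrite !comp_id -(cholds_move j q tX re okv).
  rewrite -move_update; suff -> : c (move (update e i u) i v) = j by [].
  by rewrite /c cv valKd.
Qed.

End Rainbows.

(** * The parity obstruction *)

Lemma fixedfree_involution_even (T : finType) (s : T -> T) :
  involutive s -> (forall x, s x != x) -> ~~ odd #|T|.
Proof.
move=> sK s_neq; pose A := [set x | enum_rank x < enum_rank (s x)].
suff cA : #|~: A| = #|A| by rewrite -(cardsC A) cA addnn odd_double.
rewrite -(card_imset _ (inv_inj sK)); congr #|pred_of_set _|.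
apply/setP => x.
rewrite -{1}(sK x) (mem_imset _ _ (inv_inj sK)) !inE sK -leqNgt leq_eqVlt.
case: eqP => // /val_inj/enum_rank_inj sx.
by have := s_neq x; rewrite -sx eqxx.
Qed.

(** At a vertex x the colours are at least as many as the other vertices, and
    distinct colours lead to distinct vertices.  So every edge at x has exactly
    one colour, and each colour is a perfect matching. *)
Lemma no_symmetric_edge_colouring (T J : finType) (C : J -> T -> T -> Prop) :
    odd #|T| -> 0 < #|J| -> #|J| = #|T|.-1 ->
    (forall c x, exists y, [/\ y <> x, C c x y, C c y x &
       forall c', C c' x y -> c' = c]) ->
  False.
Proof.
move=> oddT /card_gt0P[c0 _] cardJ CP.
have /fin_all_exists[F FP] c : exists f : T -> T, forall x,
    [/\ f x <> x, C c x (f x), C c (f x) x & forall c', C c' x (f x) -> c' = c].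
  by have /fin_all_exists[f fP] := CP c; exists f.
have F_onto x y : y != x -> exists c, y = F c x.
  have F_inj : injective (F^~ x).
    move=> c c' Fcc'; have [_ Cc _ _] := FP c x; have [_ _ _] := FP c' x.
    by apply; rewrite -Fcc'.
  have /eqP imF : [set F c x | c : J] == [set~ x].
    rewrite eqEcard card_imset // cardsC1 cardJ leqnn andbT.
    apply/subsetP => _ /imsetP[c _ ->]; rewrite !inE; apply/eqP.
    by case: (FP c x).
  have : (y \in [set~ x]) = (y != x) by rewrite !inE.
  by rewrite -imF => <- /imsetP[c _ ->]; exists c.
suff /negP[] : ~~ odd #|T| by [].
apply: (@fixedfree_involution_even T (F c0)) => x; last first.
  by apply/eqP; case: (FP c0 x).
have [n0 _ Cyx _] := FP c0 x.
have [c xE] : exists c, x = F c (F c0 x).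
  by apply: F_onto; rewrite eq_sym; apply/eqP.
have [_ _ _ uc] := FP c (F c0 x).
by rewrite [RHS]xE; congr (F _ _); apply: uc; rewrite -xE.
Qed.

(** * A tautology that fails in the split structure *)

Definition And a (p q : form a) : form a := Neg (Or (Neg p) (Neg q)).
Definition Ands a (i : 'I_a) (I : finType) (F : I -> form a) : form a :=
  foldr (fun x => And (F x)) (Eql i i) (enum I).
Definition Ors a (i : 'I_a) (I : finType) (F : I -> form a) : form a :=
  foldr (fun x => Or (F x)) (Neg (Eql i i)) (enum I).

Section Abbreviations.
Variables (a : nat) (U J : Type) (X : valuation a U J).
Implicit Types (e : {ffun 'I_a -> U}) (j : J) (p q : form a) (I : finType).

Lemma cholds_And e j p q :
  cholds X e j (And p q) <-> cholds X e j p /\ cholds X e j q.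
Proof.
by split=> [/not_orP[/contrapT ? /contrapT]|[? ?] /= []].
Qed.

Lemma cholds_Imp e j p q :
  cholds X e j (Imp p q) <-> (cholds X e j p -> cholds X e j q).
Proof.
split=> [[]//|pq]; have [/pq|] := EM (cholds X e j p); by [right|left].
Qed.

Lemma cholds_Ex e j i p :
  cholds X e j (Ex i p) <-> exists u j', cholds X (update e i u) j' p.
Proof. by []. Qed.

Lemma cholds_All e j i p :
  cholds X e j (All i p) <-> forall u j', cholds X (update e i u) j' p.
Proof.
split=> [np u j'|H [u [j' []]]]; last exact: H.
by apply: contrapT => nu; apply: np; exists u, j'.
Qed.

Lemma cholds_Ands e j i I (F : I -> form a) :
  cholds X e j (Ands i F) <-> forall x, cholds X e j (F x).
Proof.
suff H s : cholds X e j (foldr (fun x => And (F x)) (Eql i i) s) <->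
    forall x, x \in s -> cholds X e j (F x).
  by rewrite H; split=> HF x => [|_]; apply: HF; rewrite ?mem_enum.
elim: s => [|y s IH] //; rewrite [foldr _ _ _]/= cholds_And IH.
split=> [[Fy Fs] x|Fs]; first by rewrite inE => /predU1P[->|/Fs].
by split=> [|x xs]; apply: Fs; rewrite inE ?eqxx ?xs ?orbT.
Qed.

Lemma cholds_Ors e j i I (F : I -> form a) :
  cholds X e j (Ors i F) <-> exists x, cholds X e j (F x).
Proof.
suff H s : cholds X e j (foldr (fun x => Or (F x)) (Neg (Eql i i)) s) <->
    exists2 x, x \in s & cholds X e j (F x).
  by rewrite H; split=> [[x _ Fx]|[x Fx]]; exists x; rewrite ?mem_enum.
elim: s => [|y s IH] /=; first by split=> [[]//|[]].
rewrite IH; split=> [[Fy|[x xs Fx]]|[x]].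
- by exists y; rewrite ?inE ?eqxx.
- by exists x; rewrite ?inE ?xs ?orbT.
- by rewrite inE => /predU1P[->|]; [left | right; exists x].
Qed.

End Abbreviations.

(** With a single colour, the lemmas on abbreviated connectives also serve
    ordinary models. *)
Lemma holds_cholds a (M : model a) (e : {ffun 'I_a -> M}) p :
  holds e p <-> cholds (fun k f (_ : unit) => interp k f) e tt p.
Proof.
elim: p e => [k t|//|q IH|q IHq r IHr|i q IH] e //=.
- by rewrite IH.
- by rewrite IHq IHr.
- by split=> [[x /IH]|[x [[] /IH]]]; exists x => //; exists tt.
Qed.

Section Counterexample.
Variables (a : nat) (T : finZmodType).
Hypothesis a_ge3 : 3 <= a.

Let v0 : 'I_a := Ordinal (ltnW (ltnW a_ge3)).
Let v1 : 'I_a := Ordinal (ltnW a_ge3).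
Let v2 : 'I_a := Ordinal a_ge3.

Definition symbol : Type := option T + colour T.
Definition code (s : symbol) : nat := pickle s.

(** The unary and binary predicates are read off relations of rank a by
    repeating variables, so that their meaning depends on the displayed
    variables only; the variables from v2 on can then be reused. *)
Definition dom_at (v : 'I_a) : form a := Rel (code (inl None)) [ffun _ => v].
Definition label_at (x : T) (v : 'I_a) : form a :=
  Rel (code (inl (Some x))) [ffun i => if i == v0 then v else v2].
Definition edge (c : colour T) : form a := Rel (code (inr c)) [ffun i => i].
Definition edge_swapped (c : colour T) : form a :=
  Rel (code (inr c)) [ffun i => tperm v0 v1 i].

(** Three variables cannot count the domain predicate directly.  A bijection
    with T coded by an element of the model occupies the variable v2 only, and
    v0 and v1 suffice to state that it is a bijection. *)
Definition labelling_axiom : form a :=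
  Ex v2 (And (All v0 (Imp (dom_at v0) (Ors v0 (fun x => label_at x v0))))
    (Ands v0 (fun x : T => And (Ex v0 (And (dom_at v0) (label_at x v0)))
      (Ands v0 (fun y : T => All v0 (All v1
        (Imp (And (label_at x v0) (label_at y v1))
             (if x == y then Eql v0 v1 else Neg (Eql v0 v1))))))))).

(** Symmetry and uniqueness of the colour are required only of the partner
    chosen for v0 in colour c.  This is enough, since by counting these partners
    exhaust the other elements of the domain predicate. *)
Definition colouring_axiom : form a :=
  Ands v0 (fun c : colour T => All v0 (Imp (dom_at v0)
    (Ex v1 (And (And (dom_at v1) (Neg (Eql v0 v1)))
      (And (And (edge c) (edge_swapped c))
        (Ands v0 (fun c' => Imp (edge c')
           (if c' == c then Eql v0 v0 else Neg (Eql v0 v0))))))))).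

Definition parity_formula : form a :=
  Imp labelling_axiom (Neg colouring_axiom).

Section Meaning.
Variables (U J : Type) (X : valuation a U J).
Implicit Types (e : {ffun 'I_a -> U}) (j : J).

Lemma cholds_dom_at e j v :
  cholds X e j (dom_at v) = X (code (inl None)) [ffun _ => e v] j.
Proof. by rewrite /=; congr X; apply/ffunP => i; rewrite !ffunE. Qed.

Lemma cholds_label_at e j x v :
  cholds X e j (label_at x v) =
  X (code (inl (Some x))) [ffun i => if i == v0 then e v else e v2] j.
Proof.
by rewrite /=; congr X; apply/ffunP => i; rewrite !ffunE; case: eqP.
Qed.

Lemma cholds_edge e j c : cholds X e j (edge c) = X (code (inr c)) e j.
Proof. by rewrite /=; congr X; apply/ffunP => i; rewrite !ffunE. Qed.

Lemma cholds_edge_swapped e u w j c :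
  cholds X (update (update e v0 u) v1 w) j (edge_swapped c) =
  X (code (inr c)) (update (update e v0 w) v1 u) j.
Proof.
rewrite /=; congr X; apply/ffunP => i; rewrite !ffunE.
by case: tpermP => [->|->|/eqP/negPf n0 /eqP/negPf n1]; rewrite /= ?n0 ?n1.
Qed.

End Meaning.

(** The labelling transports the edges in M to a symmetric edge colouring of T
    itself. *)
Lemma parity_formula_tautology :
  odd #|T| -> 1 < #|T| -> tautology parity_formula.
Proof.
move=> oddT T_gt1 M e; apply/holds_cholds.
pose X : valuation a M unit := fun k f _ => interp k f; rewrite -/X.
apply/cholds_Imp => /cholds_Ex[l [j1 /cholds_And[/cholds_All cover]]].
move=> /cholds_Ands lab /cholds_Ands col.
pose D u := X (code (inl None)) [ffun _ => u] tt.
pose L x u := X (code (inl (Some x))) [ffun i => if i == v0 then u else l] tt.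
have{} cover u : D u -> exists x, L x u.
  have /cholds_Imp := cover u tt.
  rewrite cholds_dom_at updateE eqxx => /[apply] /cholds_Ors[x].
  by rewrite cholds_label_at !updateE eqxx /=; exists x.
have /fin_all_exists[pt ptP] x : exists u, D u /\ L x u.
  have /cholds_And[/cholds_Ex[u [[] /cholds_And[Du Lu]]] _] := lab x.
  exists u; move: Du Lu.
  by rewrite cholds_dom_at cholds_label_at !updateE eqxx.
have Leq x y u w : L x u -> L y w -> if x == y then u = w else u <> w.
  move=> Lu Lw.
  have /cholds_And[_ /cholds_Ands/(_ y)/cholds_All/(_ u tt)] := lab x.
  move/cholds_All/(_ w tt)/cholds_Imp; rewrite cholds_And !cholds_label_at.
  rewrite !updateE /= => /(_ (conj Lu Lw)).
  by case: eqP => _ /=; rewrite !updateE.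
refine (@no_symmetric_edge_colouring T (colour T) (fun c x y =>
  X (code (inr c)) (update (update e v0 (pt x)) v1 (pt y)) tt) oddT _ _ _).
- by rewrite card_sig cardC1 -subn1 subn_gt0.
- by rewrite card_sig cardC1.
move=> c x; have /cholds_All/(_ (pt x) tt)/cholds_Imp := col c.
rewrite cholds_dom_at updateE eqxx => /(_ (proj1 (ptP x))).
case/cholds_Ex=> w [[] /cholds_And[/cholds_And[]]]; rewrite cholds_dom_at.
move=> Dw nw.
case/cholds_And=> /cholds_And[]; rewrite cholds_edge cholds_edge_swapped.
move=> Cxy Cyx /cholds_Ands only; rewrite !updateE eqxx /= in Dw.
have [y Ly] := cover _ Dw; have [Dy Ly'] := ptP y.
have yw : w = pt y by have := Leq y y _ _ Ly Ly'; rewrite eqxx.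
subst w; exists y; split=> // [yx|c' Cc'].
  by apply: nw; rewrite /= !updateE /= yx.
have /cholds_Imp := only c'; rewrite cholds_edge => /(_ Cc').
by case: eqP => //= _ [].
Qed.

(** The intended reading of the predicates; each rainbow is an edge of every
    colour. *)
Definition splitting : valuation a (point a T) (colour T) := fun k e j =>
  match @unpickle symbol k with
  | Some (inl None) => fibre (e v0) = Some None
  | Some (inl (Some x)) => exists y (l : {perm T}),
      [/\ e v0 = inl (None, y), e v2 = inr l & l y = x]
  | Some (inr c) => rainbow e /\ j = c
  | None => False
  end.

Lemma splitting_tame : tame splitting.
Proof.
split=> [k e j j' nr|k g e j]; rewrite /splitting;
  case: unpickle => [[[x|]|c]|] //.
- by case.
- move=> [y [l [e0 e2 ly]]]; exists (g None y), ((g None)^-1 * l)%g.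
  by rewrite !ffunE e0 e2 permM permK.
- by rewrite ffunE fibre_act.
- by case=> re ->; split=> //; apply: rainbow_act.
Qed.

(** The coordinates from 2 on make each edge of the first copy a rainbow. *)
Let base : {ffun 'I_a -> point a T} :=
  [ffun i => inl (if (i == v0) || (i == v1) then None else Some i, 0%R)].

Lemma rainbow_base (x y : T) : x != y ->
  rainbow (update (update base v0 (inl (None, x))) v1 (inl (None, y))).
Proof.
move=> xy; exists v0, v1; rewrite !updateE /=; split=> // k k0 k1.
exists k => [|l]; rewrite !updateE.
  by rewrite (negPf k0) (negPf k1) ffunE (negPf k0) (negPf k1).
case: ifP => // l1; case: ifP => // l0; rewrite ffunE l0 l1 /=.
by case.
Qed.

Lemma splittingE s e c : splitting (code s) e c =
  match s with
  | inl None => fibre (e v0) = Some None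
  | inl (Some x) => exists y (l : {perm T}),
      [/\ e v0 = inl (None, y), e v2 = inr l & l y = x]
  | inr c' => rainbow e /\ c = c'
  end.
Proof. by rewrite /splitting pickleK. Qed.

(** The identity labels the first copy of T, and the partner of x in colour c
    is x + c: any element different from x would do, as the quantifier chooses
    the colour. *)
Lemma parity_formula_not_valid (j : colour T) :
  ~ cvalid (@tame a T) parity_formula.
Proof.
move=> /(_ _ splitting_tame base j)/cholds_Imp; apply.
- apply/cholds_Ex; exists (inr 1%g), j; apply/cholds_And; split.
    apply/cholds_All => u j1; apply/cholds_Imp.
    rewrite cholds_dom_at splittingE !ffunE eqxx => fu; apply/cholds_Ors.
    case: u fu => [[_ x] [->]|//]; exists x.
    rewrite cholds_label_at splittingE !ffunE /=.
    by exists x, 1%g; rewrite perm1.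
  apply/cholds_Ands => x; apply/cholds_And; split.
    apply/cholds_Ex; exists (inl (None, x)), j; apply/cholds_And.
    rewrite cholds_dom_at cholds_label_at !splittingE !ffunE /=; split=> //.
    by exists x, 1%g; rewrite perm1.
  apply/cholds_Ands => y; apply/cholds_All => u j1; apply/cholds_All => w j2.
  apply/cholds_Imp; rewrite cholds_And !cholds_label_at !splittingE !ffunE /=.
  case=> [[x' [_ [-> [<-]]]]]; rewrite perm1 => ->.
  case=> [y' [_ [-> [<-]]]]; rewrite perm1 => ->.
  by case: eqP => [->|xy] /=; rewrite !ffunE //= => -[].
apply/cholds_Ands => c; apply/cholds_All => u j1; apply/cholds_Imp.
rewrite cholds_dom_at splittingE !ffunE eqxx.
case: u => [[_ x] [->]|//].
have xy : x != (x + val c)%R.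
  by rewrite -subr_eq0 opprD addrA subrr sub0r oppr_eq0 (valP c).
apply/cholds_Ex; exists (inl (None, x + val c)%R), c.
rewrite !cholds_And cholds_dom_at cholds_edge cholds_edge_swapped !splittingE.
rewrite !ffunE /=; split; [split=> // | split].
- by rewrite !ffunE /= => -[] /eqP; rewrite (negPf xy).
- by split; split=> //; apply: rainbow_base; rewrite // eq_sym.
- apply/cholds_Ands => c'; apply/cholds_Imp; rewrite cholds_edge splittingE.
  by case=> _ ->; rewrite eqxx.
Qed.

End Counterexample.

(** * Axiom systems *)

Lemma disjunction_free_symbols a (p : form a) :
  ~~ Or_occurs p -> size (rel_symbols p) <= 1.
Proof.
suff: ~~ Or_occurs p -> size (rel_atoms p) <= 1.
  move=> H /H; apply: leq_trans; rewrite -(size_map fst); exact: size_undup.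
by elim: p.
Qed.

Theorem theorem8 (a : nat) (ha : 3 <= a) (G : form a -> Prop)
    (hG : complete_axiom_system G) (n : nat) :
  exists p : form a,
    [/\ G p,
        n <= size (rel_symbols p),
        exists (i : nat) (t s : {perm 'I_a}),
          [/\ t != s,
              (i, [ffun k => t k]) \in rel_atoms p &
              (i, [ffun k => s k]) \in rel_atoms p]
      & [/\ Ex_occurs p, Eql_occurs p & Or_occurs p]].
Proof.
case: hG => Gtaut Gcomplete; apply: contrapT => noG.
have a_gt0 : 0 < a by apply: leq_trans ha.
(* Large enough for two sums per type, whatever the number of symbols below
   the bound.  The bound is at least 2, so that it excludes formulas without
   disjunction. *)
pose m := (\max_(k < maxn n 2) #|{: colour_type a k}|).+1.
pose T : finZmodType := 'I_m.*2.+1.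
have cardT : #|T| = m.*2.+1 by rewrite card_ord.
have T_gt1 : 1 < #|T| by rewrite cardT.
have /card_gt0P[j0 _] : 0 < #|{: colour T}|.
  by rewrite card_sig cardC1 -subn1 subn_gt0.
have Gvalid p : G p -> cvalid (@tame a T) p.
  move=> Gp; have taut := Gtaut p Gp.
  have [few|many] := ltnP (size (rel_symbols p)) (maxn n 2).
    apply: few_symbols_valid => //; rewrite cardT leqW // leq_double leqW //.
    exact: (leq_bigmax (Ordinal few)).
  have [Exp|nEx] := boolP (Ex_occurs p); last exact: quantifier_free_valid.
  have [Eqp|nEql] := boolP (Eql_occurs p); last exact: equality_free_valid.
  have [Orp|/disjunction_free_symbols le1] := boolP (Or_occurs p); last first.
    by have := leq_trans many le1; rewrite geq_max andbF.
  apply: single_permutation_valid => // k s t ks kt.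
  apply: contrapT => /eqP st; apply: noG; exists p; split=> //.
    by apply: leq_trans many; apply: leq_maxl.
  by exists k, s, t.
apply: (@parity_formula_not_valid a T ha j0).
apply: (@derivable_cvalid _ _ _ _ G) => //; first exact: tame_induced.
have taut : tautology (parity_formula T ha).
  by apply: parity_formula_tautology; rewrite // cardT /= odd_double.
have [Gp|nGp] := EM (G (parity_formula T ha)); last exact: Gcomplete.
by apply: derivable_hyp; apply: sub_Inst.
Qed.
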